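(* Let $s\le K$ be a positive integer and $q\in[1,\infty]$. Assume that the pair $(H,\|\cdot\|)$, with $H\in\mathbb{R}^{m\times M}$ and $\|\cdot\|$ a norm on $\mathbb{R}^M$, satisfies the conditions $\mathbf{Q}_{s,q}(\kappa)$ and $\mathbf{Q}_{s,1}(\varkappa)$ (associated with the matrix $A$ and the representation structure $\mathcal{S}$) with $\varkappa<1/2$ and $\kappa\ge\varkappa$. For $\lambda>0$ and $y\in\mathbb{R}^m$ let the penalized $\ell_1$ recovery $\widehat{x}_{\mathrm{pen}}(y)$ be any element of $$\mathop{\mathrm{Argmin}}_{v\in\mathbb{R}^n}\{L_1(Bv)+\lambda\|H^T(Av-y)\|\}.$$ (i) Let $\lambda\ge 2s$. Then for all $x\in\mathbb{R}^n$, $y\in\mathbb{R}^m$ and $1\le p\le q$, $$L_p(B[\widehat{x}_{\mathrm{pen}}(y)-x])\le\frac{4\lambda^{1/p}}{1-2\varkappa}\Big[1+\frac{\kappa\lambda}{2s}-\varkappa\Big]^{\frac{q(p-1)}{p(q-1)}}\Big[\|H^T(Ax-y)\|+\frac{1}{2s}L_1(Bx-[Bx]^s)\Big].$$ In particular, with $\lambda=2s$, for $1\le p\le q$, $$L_p(B[\widehat{x}_{\mathrm{pen}}(y)-x])\le\frac{4(2s)^{1/p}}{1-2\varkappa}[1+\kappa-\varkappa]^{\frac{q(p-1)}{p(q-1)}}\Big[\|H^T(Ax-y)\|+\frac{1}{2s}L_1(Bx-[Bx]^s)\Big].$$ (ii) Let $\rho\ge0$ and $\Xi=\{\xi\in\mathbb{R}^m:\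 \|H^T(u+\xi)\|\le\rho\ \ \forall u\in\mathcal{U}\}$. Then for all $x\in\mathbb{R}^n$, $u\in\mathcal{U}$, $\xi\in\Xi$ and $1\le p\le q$: if $\lambda\ge2s$, then $$L_p(B[\widehat{x}_{\mathrm{pen}}(Ax+u+\xi)-x])\le\frac{4\lambda^{1/p}}{1-2\varkappa}\Big[1+\frac{\kappa\lambda}{2s}-\varkappa\Big]^{\frac{q(p-1)}{p(q-1)}}\Big[\rho+\frac{1}{2s}L_1(Bx-[Bx]^s)\Big],$$ and if $\lambda=2s$, then $$L_p(B[\widehat{x}_{\mathrm{pen}}(Ax+u+\xi)-x])\le\frac{4(2s)^{1/p}}{1-2\varkappa}[1+\kappa-\varkappa]^{\frac{q(p-1)}{p(q-1)}}\Big[\rho+\frac{1}{2s}L_1(Bx-[Bx]^s)\Big].$$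
   Context: Setting: $A\in\mathbb{R}^{m\times n}$ is a given sensing matrix, and $\mathcal{U}\subset\mathbb{R}^m$ is a given compact convex set symmetric w.r.t. the origin. A representation structure (r.s.) $\mathcal{S}=(B,n_1,\dots,n_K,\|\cdot\|_{(1)},\dots,\|\cdot\|_{(K)})$ consists of positive integers $n_1,\dots,n_K$ with $N=n_1+\cdots+n_K$, a matrix $B=[B[1];\dots;B[K]]\in\mathbb{R}^{N\times n}$ (vertical concatenation, $B[k]\in\mathbb{R}^{n_k\times n}$), and norms $\|\cdot\|_{(k)}$ on $\mathbb{R}^{n_k}$. Vectors $w\in\mathbb{R}^N=\mathbb{R}^{n_1}\times\cdots\times\mathbb{R}^{n_K}$ are written in blocks $w=[w[1];\dots;w[K]]$, $w[k]\in\mathbb{R}^{n_k}$; the magnitude of block $k$ is $\|w[k]\|_{(k)}$. For $1\le p\le\infty$, $L_p(w)=\|[\|w[1]\|_{(1)};\dots;\|w[K]\|_{(K)}]\|_p$. The vector $w^s$ (also written $[w]^s$) is obtained from $w$ by zeroing out all but the $s$ blocks largest in magnitude (ties resolved arbitrarily), and $L_{s,p}(w)=L_p(w^s)$. Condition $\mathbf{Q}_{s,q}(\kappa)$ (for a positive integer $s\le K$, $q\in[1,\infty]$, $\kappa\ge0$) associated with $A$ and $\mathcal{S}$: a pair $(H,\|\cdot\|)$, $H\in\mathbb{R}^{m\times M}$, $\|\cdot\|$ a norm on $\mathbb{R}^M$, satisfies it if $$L_{s,q}(Bx)\le s^{1/q}\|H^TAx\|+\kappa s^{1/q-1}L_1(Bx)\qquad\forall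 x\in\mathbb{R}^n.$$ Conventions: $1/\infty=0$; the exponent $\frac{q(p-1)}{p(q-1)}=\frac{1-1/p}{1-1/q}$ is read by continuity for infinite $p,q$ (so it is $1-1/p$ if $q=\infty$), and it equals $0$ when $p=1$ (including $p=q=1$). *)

(* Defs.v *)
From mathcomp Require Import all_boot all_order all_algebra.
From mathcomp Require Import all_classical all_reals all_analysis.
Import Order.TTheory GRing.Theory Num.Theory.
Import numFieldNormedType.Exports.

Set Implicit Arguments.
Unset Strict Implicit.
Unset Printing Implicit Defensive.

Local Open Scope classical_set_scope.
Local Open Scope ring_scope.

Record is_norm (R : realType) (V : lmodType R) (f : V -> R) : Prop := IsNorm {
  is_norm_ge0 : forall x, 0 <= f x;
  is_norm_eq0 : forall x, f x = 0 -> x = 0;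
  is_normZ : forall (a : R) x, f (a *: x) = `|a| * f x;
  is_norm_triangle : forall x y, f (x + y) <= f x + f y }.

(* Exponents p, q in [1, +oo] are extended reals. *)

(* 1 / p as a real number, with 1 / +oo = 0. *)
Definition rinv (R : realType) (p : \bar R) : R := fine (p^-1)%E.

(* The exponent q (p - 1) / (p (q - 1)), written (1 - 1/p) / (1 - 1/q) so that
   infinite p, q are covered. When p = 1 the value is 0, also for q = 1, since
   0 / 0 = 0. *)
Definition pq_exponent (R : realType) (p q : \bar R) : R :=
  (1 - rinv p) / (1 - rinv q).

(* Only used for 1 <= p; the value at -oo is junk. *)
Definition lp_norm (R : realType) (K : nat) (p : \bar R) (t : 'I_K -> R) : R :=
  match p with
  | r%:E => (\sum_(k < K) `|t k| `^ r) `^ r^-1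
  | +oo%E => \big[Num.max/0]_(k < K) `|t k|
  | -oo%E => 0
  end.

Record rep_struct (R : realType) (n K : nat) := RepStruct {
  rs_dim : 'I_K -> nat;
  rs_dim_gt0 : forall k, (0 < rs_dim k)%N;
  rs_mat : 'M[R]_(\sum_(k < K) rs_dim k, n);
  rs_norm : forall k, 'cV[R]_(rs_dim k) -> R;
  rs_normP : forall k, is_norm (@rs_norm k) }.
Arguments rs_norm {R n K} r k _.

Notation rs_vec R S := 'cV[R]_(\sum_k rs_dim S k).

Section BlockNorms.
Variables (R : realType) (n K : nat) (S : rep_struct R n K).
Implicit Types (w : rs_vec R S) (s : nat) (p : \bar R).

Definition block_mag w (k : 'I_K) : R := rs_norm S k (submxcol w k).

Definition block_lp p w : R := lp_norm p (block_mag w).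

(* sel s w is the set of the s blocks of w that are retained in w^s. The results
   are stated for every such sel, i.e. for every way of resolving ties. *)
Definition block_selection (sel : nat -> rs_vec R S -> {set 'I_K}) : Prop :=
  forall s w, (s <= K)%N ->
    #|sel s w| = s /\
    (forall i j, i \in sel s w -> j \notin sel s w ->
       block_mag w j <= block_mag w i).

Variable sel : nat -> rs_vec R S -> {set 'I_K}.

Definition block_trunc s w : rs_vec R S :=
  \mxcol_(k < K) (if k \in sel s w then submxcol w k else 0).

Definition block_lsp s p w : R := block_lp p (block_trunc s w).

Definition condQ (m M : nat) (A : 'M[R]_(m, n)) (H : 'M[R]_(m, M))
    (nu : 'cV[R]_M -> R) s (q : \bar R) (kappa : R) : Prop :=
  forall x : 'cV[R]_n,
    block_lsp s q (rs_mat S *m x) <=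
      s%:R `^ rinv q * nu (H^T *m (A *m x))
      + kappa * s%:R `^ (rinv q - 1) * block_lp 1%E (rs_mat S *m x).

End BlockNorms.

Definition pen_argmin (R : realType) (n K : nat) (S : rep_struct R n K)
    (m M : nat) (A : 'M[R]_(m, n)) (H : 'M[R]_(m, M)) (nu : 'cV[R]_M -> R)
    (lambda : R) (y : 'cV[R]_m) : set 'cV[R]_n :=
  let obj v := block_lp 1%E (rs_mat S *m v) + lambda * nu (H^T *m (A *m v - y)) in
  [set v | forall z, obj v <= obj z].

Definition noise_set (R : realType) (m M : nat) (U : set 'cV[R]_m)
    (H : 'M[R]_(m, M)) (nu : 'cV[R]_M -> R) (rho : R) : set 'cV[R]_m :=
  [set xi | forall u, U u -> nu (H^T *m (u + xi)) <= rho].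

(* Main.v *)
Require Import Defs.
From mathcomp Require Import all_boot all_order all_algebra.
From mathcomp Require Import all_classical all_reals all_analysis.
From mathcomp Require Import ring lra.
Import Order.TTheory GRing.Theory Num.Theory.
Import numFieldNormedType.Exports.

(** Write z = B (xpen - x), t_k for the magnitude of its k-th block, I for the s
    blocks of B x that are retained in [B x]^s, and
    D = ||H^T (A x - y)|| + L_1(B x - [B x]^s) / (2 s).

    The penalized objective at xpen does not exceed its value at x. The triangle
    inequality on each block turns this into a cone-type inequality
    ([pen_argmin_cone]): the mass of t outside I, plus lambda ||H^T A (xpen - x)||,
    is at most the mass of t on I plus an error controlled by lambda D.
    Condition Q_{s,1} bounds the mass on I in its turn, since the s blocks of z
    largest in magnitude carry at least as much mass as I does
    ([bigger_sum_retained]). Because vkappa < 1/2 and lambda >= 2 s, solving the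
    two inequalities bounds both sum_k t_k and ||H^T A (xpen - x)|| by multiples
    of D ([pen_argmin_l1_bounds]).

    Put E = 4 D / (1 - 2 vkappa) and beta = 1 + kappa lambda / (2 s) - vkappa, so
    that sum_k t_k <= lambda E / 2. Inserting the two bounds into condition
    Q_{s,q} gives L_{s,q}(z) <= s^(1/q) E beta. Every block that is not among
    the s largest then has magnitude at most E beta, so its q-th power is at most
    (E beta)^(q-1) t_k, and the tail contributes at most (lambda / 2) (E beta)^q
    to the q-th power of the norm. The s largest blocks contribute at most
    s (E beta)^q with s <= lambda / 2, whence L_q(z) <= lambda^(1/q) E beta
    ([lp_norm_of_retained]).

    The bounds on L_1 and L_q interpolate ([lp_norm_interpolation]) to
    L_p(z) <= lambda^(1/p) E beta^theta, theta = (1 - 1/p) / (1 - 1/q), which is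
    the claimed estimate. For observations y = A x + u + xi, the noise enters
    only through ||H^T (A x - y)|| = ||H^T (u + xi)|| <= rho. *)

Set Implicit Arguments.
Unset Strict Implicit.
Unset Printing Implicit Defensive.

Local Open Scope classical_set_scope.
Local Open Scope ring_scope.

(** * Finite nonnegative sequences *)

(** A threshold c separates the entries kept in J from the others, so passing
    from I to J can only increase each term of the sum of t - c; the
    subtracted constants agree because the two sets have the same size. *)
Lemma bigger_sum_retained (R : realDomainType) (K : nat) (t : 'I_K -> R)
    (I J : {set 'I_K}) :
  (forall k, 0 <= t k) -> #|I| = #|J| ->
  (forall i j, i \in J -> j \notin J -> t j <= t i) ->
  \sum_(k in I) t k <= \sum_(k in J) t k.
Proof.
move=> t_ge0 cardIJ topJ.
pose c := \big[Num.max/0]_(k | k \notin J) t k.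
have le_sum : \sum_(k in I) (t k - c) <= \sum_(k in J) (t k - c).
  rewrite big_mkcond [leRHS]big_mkcond; apply: ler_sum => k _.
  case: (boolP (k \in J)) => kJ; case: ifP => // _.
    by rewrite subr_ge0; apply: bigmax_le => // j jJ; exact: topJ.
  by rewrite subr_le0; exact: le_bigmax_cond.
by move: le_sum; rewrite !sumrB !sumr_const cardIJ lerD2r.
Qed.

Section FiniteSequences.
Variables (R : realType) (K : nat).
Implicit Types (t : 'I_K -> R) (p q c C E beta lambda : R).

(** The weighted arithmetic-geometric mean inequality is Young's inequality for
    the conjugate exponents 1/a and 1/b. *)
Lemma powR_weighted_amgm (u v a b : R) :
  0 <= u -> 0 <= v -> 0 < a -> 0 < b -> a + b = 1 ->
  u `^ a * v `^ b <= a * u + b * v.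
Proof.
move=> u0 v0 a0 b0 ab1.
have := @conjugate_powR R (u `^ a) (v `^ b) a^-1 b^-1
  (powR_ge0 _ _) (powR_ge0 _ _).
rewrite !invr_gt0 !invrK -!powRrM !mulfV ?gt_eqF // !powRr1 //.
by rewrite ![_ * a]mulrC ![_ * b]mulrC; exact.
Qed.

Lemma lp_norm1E t : (forall k, 0 <= t k) -> lp_norm 1%E t = \sum_k t k.
Proof.
move=> t0; rewrite /lp_norm invr1 powRr1; last first.
  by apply: sumr_ge0 => k _; exact: powR_ge0.
by apply: eq_bigr => k _; rewrite ger0_norm // powRr1.
Qed.

(** Bounds are normalized as c^(1/p) C, modelled on a sequence of c entries
    equal to C. For finite p this is a linear bound on the sum of p-th powers;
    for p = oo ([lp_norm_pinfty_le]) the factor in c disappears. *)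
Lemma lp_norm_fin_le p c C t : 0 < p -> 0 <= c -> 0 <= C ->
  (forall k, 0 <= t k) ->
  (lp_norm p%:E t <= c `^ rinv p%:E * C) = (\sum_k t k `^ p <= c * C `^ p).
Proof.
move=> p0 c0 C0 t0; rewrite /rinv fine_invr /lp_norm.
under eq_bigr do rewrite ger0_norm //.
set s := \sum_k _; have s0 : 0 <= s by apply: sumr_ge0 => k _; exact: powR_ge0.
have p'0 : 0 < p^-1 by rewrite invr_gt0.
have -> : c `^ p^-1 * C = (c * C `^ p) `^ p^-1.
  by rewrite powRM ?powR_ge0 // -powRrM mulfV ?gt_eqF // powRr1.
have cC0 : 0 <= c * C `^ p by rewrite mulr_ge0 // powR_ge0.
apply/idP/idP => [le_r|]; last first.
  by apply: ge0_ler_powR; rewrite ?nnegrE ?(ltW p'0).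
have := ge0_ler_powR (ltW p0) _ _ le_r.
by rewrite !nnegrE !powR_ge0 -!powRrM mulVf ?gt_eqF // !powRr1 //; exact.
Qed.

Lemma lp_norm_pinfty_le c C t : 0 <= C -> (forall k, 0 <= t k) ->
  lp_norm +oo%E t <= c `^ rinv +oo%E * C <-> forall k, t k <= C.
Proof.
move=> C0 t0; rewrite /rinv invey powRr0 mul1r /lp_norm; split=> [tC k|tC].
  apply: le_trans tC; rewrite -[leLHS]ger0_norm //.
  exact: (le_bigmax _ (fun k => `|t k|)).
by apply: bigmax_le => // k _; rewrite ger0_norm.
Qed.

(** Each retained entry dominates every discarded one, so the norm of the
    retained part bounds each discarded entry by C. Among sequences with entries
    at most C, the sum of q-th powers is at most C^(q-1) times the sum. *)
Lemma lp_norm_of_retained (q : \bar R) (J : {set 'I_K}) C c t :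
  (1 <= q)%E -> (forall k, 0 <= t k) -> 0 <= C -> 0 <= c -> (0 < #|J|)%N ->
  (forall i j, i \in J -> j \notin J -> t j <= t i) ->
  lp_norm q (fun k => if k \in J then t k else 0) <= #|J|%:R `^ rinv q * C ->
  \sum_k t k <= c * C ->
  lp_norm q t <= (#|J|%:R + c) `^ rinv q * C.
Proof.
move=> q1 t0 C0 c0 J0 topJ.
have tJ0 k : 0 <= (if k \in J then t k else 0) by case: ifP.
case: q q1 => [q||] // q1; last first.
  move=> /(lp_norm_pinfty_le _ C0 tJ0) tJC _.
  have tJ i : i \in J -> t i <= C by move=> iJ; have := tJC i; rewrite iJ.
  apply/lp_norm_pinfty_le => // k; case: (boolP (k \in J)) => [/tJ//|kJ].
  by have /card_gt0P[i iJ] := J0; exact: le_trans (topJ _ _ iJ kJ) (tJ _ iJ).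
have {}q1 : 1 <= q by rewrite -lee_fin.
have q0 : 0 < q by exact: lt_le_trans q1.
move=> + sumt.
rewrite !lp_norm_fin_le // ?addr_ge0 // => tJC.
have {}tJC : \sum_(k in J) t k `^ q <= #|J|%:R * C `^ q.
  apply: le_trans tJC; rewrite big_mkcond; apply: ler_sum => k _.
  by case: ifP => //; rewrite powR_ge0.
have tC j : j \notin J -> t j <= C.
  move=> jJ.
  (* #|J| copies of t_j^q are dominated by the retained q-th powers. *)
  have jC : t j `^ q <= C `^ q.
    rewrite -(ler_pM2l (_ : 0 < #|J|%:R)) ?ltr0n //; apply: le_trans tJC.
    rewrite mulr_natl -sumr_const; apply: ler_sum => i iJ.
    by apply: ge0_ler_powR; rewrite ?nnegrE ?(ltW q0) ?topJ.
  rewrite leNgt; apply/negP => Cj; move: jC; rewrite leNgt => /negP; apply.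
  by apply: gt0_ltr_powR; rewrite ?nnegrE.
rewrite (bigID [in J]) /= mulrDl lerD //.
apply: (@le_trans _ _ (C `^ (q - 1) * \sum_(k | k \notin J) t k)).
  rewrite mulr_sumr; apply: ler_sum => k kJ.
  rewrite -mulr_powRB1 // mulrC ler_wpM2r //.
  by apply: ge0_ler_powR; rewrite ?nnegrE ?subr_ge0 ?tC.
rewrite -(mulr_powRB1 C0 q0) mulrA mulrC ler_wpM2r ?powR_ge0 //.
apply: le_trans sumt; rewrite [leRHS](bigID [in J]) /= lerDr.
exact: sumr_ge0.
Qed.

(** Hoelder interpolation between exponents 1 and q. When 1 < p < q < oo, write
    p = a + q b with a + b = 1; then pq_exponent p q = q b / p, and each term
    satisfies t_k^p = E^p beta^(q b) u^a v^b with u = t_k / E and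
    v = (t_k / (E beta))^q. The arithmetic-geometric mean inequality replaces
    u^a v^b by a u + b v, and both u and v sum to at most lambda. *)
Lemma lp_norm_interpolation (p q : \bar R) lambda E beta t :
  (1 <= p)%E -> (p <= q)%E -> (forall k, 0 <= t k) ->
  0 < lambda -> 0 <= E -> 0 < beta ->
  \sum_k t k <= lambda * E ->
  lp_norm q t <= lambda `^ rinv q * (E * beta) ->
  lp_norm p t <= lambda `^ rinv p * (E * beta `^ pq_exponent p q).
Proof.
move=> p1 pq t0 l0 E0 b0 sumt.
have l'0 := ltW l0; have b'0 := ltW b0.
have EX0 x : 0 <= E * beta `^ x by rewrite mulr_ge0 ?powR_ge0.
have EB0 : 0 <= E * beta by rewrite mulr_ge0.
rewrite /pq_exponent; case: p p1 pq => [p||] // p1 pq; last first.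
  move: pq; rewrite leye_eq => /eqP ->.
  by rewrite {2 3}/rinv invey subr0 divr1 powRr1.
have {}p1 : 1 <= p by rewrite -lee_fin.
have p0 : 0 < p by exact: lt_le_trans p1.
have rp : rinv p%:E = p^-1 by rewrite /rinv fine_invr.
have [->|pN1] := eqVneq p 1.
  move=> _; rewrite /rinv !fine_invr invr1 subrr mul0r powRr0 mulr1 lp_norm1E //.
  by rewrite powRr1.
have {}p1 : 1 < p by rewrite lt_neqAle eq_sym pN1.
have pm1 : 0 < p - 1 by rewrite subr_gt0.
case: q pq => [q||] // pq; last first.
  move=> /(lp_norm_pinfty_le _ EB0 t0) tC.
  rewrite lp_norm_fin_le // rp {1}/rinv invey subr0 divr1.
  rewrite powRM ?powR_ge0 // -powRrM mulrBl mul1r mulVf ?gt_eqF //.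
  apply: (@le_trans _ _ ((E * beta) `^ (p - 1) * \sum_k t k)).
    rewrite mulr_sumr; apply: ler_sum => k kJ.
    rewrite -mulr_powRB1 // mulrC ler_wpM2r //.
    by apply: ge0_ler_powR; rewrite ?nnegrE ?(ltW pm1).
  rewrite powRM // -(mulr_powRB1 E0 p0).
  apply: le_trans (ler_wpM2l _ sumt) _; first by rewrite mulr_ge0 ?powR_ge0.
  by rewrite le_eqVlt; apply/orP; left; apply/eqP; ring.
have {}pq : p <= q by rewrite -lee_fin.
have q0 : 0 < q by exact: lt_le_trans pq.
have q1 : 1 < q by exact: lt_le_trans pq.
have qm1 : 0 < q - 1 by rewrite subr_gt0.
have rq : rinv q%:E = q^-1 by rewrite /rinv fine_invr.
have [<-|pNq] := eqVneq p q.
  by rewrite divff ?powRr1 // rp subr_eq0 eq_sym invr_eq1.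
have {}pq : p < q by rewrite lt_neqAle pNq.
rewrite !lp_norm_fin_le // => sumtq.
(* The rescaling by E below requires E > 0; when E = 0 the sequence vanishes. *)
have [E00|EN0] := eqVneq E 0.
  have tE k : t k = 0.
    have s0 : \sum_k t k = 0.
      by apply/le_anti; rewrite sumr_ge0 // andbT; move: sumt; rewrite E00 mulr0.
    move/eqP: s0; rewrite psumr_eq0 // => /allP/(_ k).
    by rewrite mem_index_enum => /(_ isT)/eqP.
  by rewrite big1 ?mulr_ge0 ?powR_ge0 // => k _; rewrite tE powR0 // gt_eqF.
have {EN0}E'0 : 0 < E by rewrite lt_neqAle eq_sym EN0.
pose a := (q - p) / (q - 1); pose b := (p - 1) / (q - 1).
have a0 : 0 < a by rewrite divr_gt0 // subr_gt0.
have pos_b : 0 < b by rewrite divr_gt0.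
have qm1N0 : q - 1 != 0 by rewrite gt_eqF.
have ab1 : a + b = 1 by rewrite /a /b; field.
have apq : a + q * b = p by rewrite /a /b; field.
rewrite rp rq.
have -> : (1 - p^-1) / (1 - q^-1) = q * b / p.
  by rewrite /b; field; rewrite qm1N0 !gt_eqF.
rewrite powRM ?powR_ge0 // -powRrM divfK ?gt_eqF //.
set F := E `^ p * _.
have F0 : 0 <= F by rewrite mulr_ge0 ?powR_ge0.
have Cq0 : 0 < (E * beta) `^ q by rewrite powR_gt0 // mulr_gt0.
have young k : t k `^ p <= F * (a * (t k / E) + b * (t k `^ q / (E * beta) `^ q)).
  have u0 : 0 <= t k / E by rewrite divr_ge0.
  have v0 : 0 <= t k `^ q / (E * beta) `^ q by rewrite divr_ge0 ?powR_ge0.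
  apply: le_trans (ler_wpM2l F0 (powR_weighted_amgm u0 v0 a0 pos_b ab1)).
  rewrite le_eqVlt; apply/orP; left; apply/eqP.
  have : t k = E * (t k / E) by rewrite mulrC divfK ?gt_eqF.
  move: (t k / E) u0 => u u0 ->.
  have -> : (E * u) `^ q / (E * beta) `^ q = u `^ q * beta `^ (- q).
    by rewrite !powRM // powRN; field; rewrite !gt_eqF ?powR_gt0.
  rewrite !powRM ?powR_ge0 // -!powRrM /F.
  have -> : u `^ p = u `^ a * u `^ (q * b) by rewrite -powRD ?apq // gt_eqF.
  by rewrite mulNr powRN; field; rewrite gt_eqF // powR_gt0.
apply: le_trans (ler_sum _ (fun k _ => young k)) _.
rewrite -mulr_sumr mulrC ler_wpM2r // big_split /= -!mulr_sumr -!mulr_suml.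
have -> : lambda = a * lambda + b * lambda by rewrite -mulrDl ab1 mul1r.
by rewrite lerD // ler_wpM2l ?(ltW a0) ?(ltW pos_b) // ler_pdivrMr.
Qed.

End FiniteSequences.

(** * Norms of blocks *)

Lemma is_norm0 (R : realType) (V : lmodType R) (f : V -> R) :
  is_norm f -> f 0 = 0.
Proof. by move=> fP; rewrite -(scale0r 0) (is_normZ fP) normr0 mul0r. Qed.

Lemma is_normN (R : realType) (V : lmodType R) (f : V -> R) (v : V) :
  is_norm f -> f (- v) = f v.
Proof. by move=> fP; rewrite -scaleN1r (is_normZ fP) normrN1 mul1r. Qed.

Section Blocks.
Variables (R : realType) (n K : nat) (S : rep_struct R n K).
Implicit Types (v w : rs_vec R S).

Lemma block_mag_ge0 w k : 0 <= block_mag w k.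
Proof. exact: is_norm_ge0 (rs_normP S k) _. Qed.

Lemma block_magD v w k : block_mag (v + w) k <= block_mag v k + block_mag w k.
Proof. by rewrite /block_mag submxcolD; exact: is_norm_triangle (rs_normP S k) _ _. Qed.

Lemma block_magN w k : block_mag (- w) k = block_mag w k.
Proof.
rewrite /block_mag submxcolN; exact: is_normN (rs_normP S k).
Qed.

Lemma block_lp1E w : block_lp 1%E w = \sum_k block_mag w k.
Proof. by apply: lp_norm1E => k; exact: block_mag_ge0. Qed.

Lemma block_mag_trunc sel s w k :
  block_mag (block_trunc sel s w) k =
  if k \in sel s w then block_mag w k else 0.
Proof.
rewrite /block_mag /block_trunc mxcolK; case: ifP => // _.
exact: is_norm0 (rs_normP S k).
Qed.

Lemma block_lsp1E sel s w :
  block_lsp sel s 1%E w = \sum_(k in sel s w) block_mag w k.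
Proof.
rewrite /block_lsp block_lp1E [RHS]big_mkcond.
by apply: eq_bigr => k _; exact: block_mag_trunc.
Qed.

Lemma block_lp1_tail sel s w :
  block_lp 1%E (w - block_trunc sel s w) =
  \sum_(k | k \notin sel s w) block_mag w k.
Proof.
rewrite block_lp1E [RHS]big_mkcond; apply: eq_bigr => k _.
rewrite /block_mag submxcolB /block_trunc mxcolK; case: ifP => _ /=.
  by rewrite subrr; exact: is_norm0 (rs_normP S k).
by rewrite subr0.
Qed.

Lemma block_lspE sel s q w :
  block_lsp sel s q w =
  lp_norm q (fun k => if k \in sel s w then block_mag w k else 0).
Proof.
by congr lp_norm; apply/funext => k; exact: block_mag_trunc.
Qed.

End Blocks.

(** * Penalized recovery *)

Local Arguments block_lp : simpl never.
Local Arguments block_lsp : simpl never.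

Section PenalizedRecovery.
Variables (R : realType) (m n K M : nat) (A : 'M[R]_(m, n)).
Variables (S : rep_struct R n K) (sel : nat -> rs_vec R S -> {set 'I_K}).
Hypothesis selP : block_selection sel.
Variables (s : nat) (H : 'M[R]_(m, M)) (nu : 'cV[R]_M -> R).
Hypotheses (s_gt0 : (0 < s)%N) (s_leK : (s <= K)%N) (nuP : is_norm nu).

(** On the blocks in I the norm of B xpen is at least that of B x minus that of z,
    and outside I at least that of z minus that of B x. Summing and comparing
    the objective at xpen and x, the mass of B x on I cancels while its tail is
    counted twice. *)
Lemma pen_argmin_cone lambda x y xpen : 0 <= lambda ->
  pen_argmin S A H nu lambda y xpen ->
  let w := rs_mat S *m x in let z := rs_mat S *m (xpen - x) in
  \sum_(k | k \notin sel s w) block_mag z k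
    + lambda * nu (H^T *m (A *m (xpen - x))) <=
  \sum_(k in sel s w) block_mag z k
    + 2 * block_lp 1%E (w - block_trunc sel s w)
    + 2 * lambda * nu (H^T *m (A *m x - y)).
Proof.
move=> l0 /(_ x) /=; set w := rs_mat S *m x; set z := rs_mat S *m (xpen - x).
have xpenE : rs_mat S *m xpen = w + z by rewrite -mulmxDr addrC subrK.
rewrite xpenE block_lp1_tail !block_lp1E.
set r := nu (H^T *m (A *m x - y)); set a := nu (H^T *m (A *m (xpen - x))).
have ar : a - r <= nu (H^T *m (A *m xpen - y)).
  rewrite lerBlDr /r -(is_normN (H^T *m (A *m x - y)) nuP) -mulmxN.
  apply: le_trans (is_norm_triangle nuP _ _).
  by rewrite -mulmxDr opprB addrA subrK -mulmxBr.
rewrite (bigID [in sel s w]) [in leRHS](bigID [in sel s w]) /=.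
have on_I : \sum_(k in sel s w) block_mag w k <=
    \sum_(k in sel s w) block_mag (w + z) k + \sum_(k in sel s w) block_mag z k.
  rewrite -big_split; apply: ler_sum => k _ /=.
  by rewrite -(block_magN z); apply: le_trans (block_magD _ _ _); rewrite addrK.
have off_I : \sum_(k | k \notin sel s w) block_mag z k <=
    \sum_(k | k \notin sel s w) block_mag (w + z) k
    + \sum_(k | k \notin sel s w) block_mag w k.
  rewrite -big_split; apply: ler_sum => k _ /=.
  by rewrite -(block_magN w); apply: le_trans (block_magD _ _ _); rewrite addrC addKr.
move: (ler_wpM2l l0 ar); rewrite mulrBr -mulrA.
move: on_I off_I; set s1 := \sum_(_ in _) block_mag w _.
lra.
Qed.

(** With a = ||H^T A (xpen - x)||, twice the bound s a + vkappa L_1(z) on the mass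
    on I, inserted into the cone inequality, produces 2 s a on the right, which
    lambda a on the left absorbs because lambda >= 2 s. The cone inequality
    then also gives lambda a <= L_1(z) + 2 lambda D. *)
Lemma pen_argmin_l1_bounds lambda vkappa x y xpen :
  0 <= vkappa -> vkappa < 1 / 2 -> condQ sel A H nu s 1%E vkappa ->
  2 * s%:R <= lambda -> pen_argmin S A H nu lambda y xpen ->
  let D := nu (H^T *m (A *m x - y)) + (2 * s%:R)^-1 *
    block_lp 1%E (rs_mat S *m x - block_trunc sel s (rs_mat S *m x)) in
  block_lp 1%E (rs_mat S *m (xpen - x)) <= 2 * lambda * D / (1 - 2 * vkappa) /\
  nu (H^T *m (A *m (xpen - x))) <=
    4 * (1 - vkappa) * D / (1 - 2 * vkappa).
Proof.
move=> vk0 vk2 Q1 l2s pen.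
have s0 : 0 < s%:R :> R by rewrite ltr0n.
have l0 : 0 < lambda by lra.
have := pen_argmin_cone x (ltW l0) pen; have := Q1 (xpen - x).
rewrite /rinv inve1 /= subrr powRr0 powRr1 ?ler0n // mulr1 block_lsp1E.
set w := rs_mat S *m x; set z := rs_mat S *m (xpen - x).
set e := block_lp 1%E (w - _); set r := nu (_ *m (_ - y)).
set a := nu (_ *m (A *m (xpen - x))).
have [cardI _] := selP w s_leK; have [cardJ topJ] := selP z s_leK.
have top : \sum_(k in sel s w) block_mag z k <= \sum_(k in sel s z) block_mag z k.
  apply: bigger_sum_retained topJ; last by rewrite cardI cardJ.
  by move=> k; exact: block_mag_ge0.
have e0 : 0 <= e.
  by rewrite /e block_lp1E; apply: sumr_ge0 => k _; exact: block_mag_ge0.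
have a0 : 0 <= a by exact: is_norm_ge0.
have r0 : 0 <= r by exact: is_norm_ge0.
have -> : block_lp 1%E z = \sum_(k in sel s w) block_mag z k
    + \sum_(k | k \notin sel s w) block_mag z k.
  by rewrite block_lp1E (bigID [in sel s w]).
set tI := \sum_(k in sel s w) _ in top *; set tO := \sum_(k | k \notin _) _.
have tI0 : 0 <= tI by apply: sumr_ge0 => k _; exact: block_mag_ge0.
have tO0 : 0 <= tO by apply: sumr_ge0 => k _; exact: block_mag_ge0.
move=> q1 cone.
set D := r + _.
(* The cone inequality weights e and lambda r equally, while lambda D contains e
   with the factor lambda / (2 s) >= 1. *)
have eD : e + lambda * r <= lambda * D.
  rewrite /D mulrDr addrC lerD2l mulrA -[leLHS]mul1r ler_wpM2r //.
  by rewrite ler_pdivlMr ?mul1r // mulr_gt0.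
have vk' : 0 < 1 - 2 * vkappa by lra.
have sa : 2 * s%:R * a <= lambda * a by rewrite ler_wpM2r.
have l1 : (tI + tO) * (1 - 2 * vkappa) <= 2 * lambda * D.
  by rewrite -mulrA in cone; rewrite -!mulrA; lra.
split; first by rewrite ler_pdivlMr.
rewrite ler_pdivlMr // -(ler_pM2l l0).
have aB : lambda * a <= tI + tO + 2 * (lambda * D).
  by rewrite -mulrA in cone; lra.
move: (ler_wpM2r (ltW vk') aB) l1; rewrite -!mulrA.
set la := lambda * D; nra.
Qed.

(** The choice lambda = 2 s and the observations A x + u + xi are both special
    cases of this estimate. *)
Lemma penalized_recovery_bound (lambda kappa vkappa : R) (p q : \bar R) x y xpen :
  (1 <= p)%E -> (p <= q)%E ->
  0 <= vkappa -> vkappa < 1 / 2 -> vkappa <= kappa ->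
  condQ sel A H nu s q kappa -> condQ sel A H nu s 1%E vkappa ->
  2 * s%:R <= lambda -> pen_argmin S A H nu lambda y xpen ->
  block_lp p (rs_mat S *m (xpen - x)) <=
    4 * lambda `^ rinv p / (1 - 2 * vkappa)
    * (1 + kappa * lambda / (2 * s%:R) - vkappa) `^ pq_exponent p q
    * (nu (H^T *m (A *m x - y))
       + (2 * s%:R)^-1
         * block_lp 1%E (rs_mat S *m x - block_trunc sel s (rs_mat S *m x))).
Proof.
move=> p1 pq vk0 vk2 vkk Qq Q1 l2s pen.
have q1 : (1 <= q)%E by exact: le_trans pq.
have := pen_argmin_l1_bounds x vk0 vk2 Q1 l2s pen.
set z := rs_mat S *m (xpen - x).
set D := nu _ + _; set a := nu _; set beta := 1 + _ - _ => -[l1 aB].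
have s0 : 0 < s%:R :> R by rewrite ltr0n.
have l0 : 0 < lambda by lra.
have vk' : 0 < 1 - 2 * vkappa by lra.
have D0 : 0 <= D.
  apply: addr_ge0; first exact: is_norm_ge0.
  apply: mulr_ge0; first by rewrite invr_ge0 mulr_ge0.
  by rewrite block_lp1E; apply: sumr_ge0 => k _; exact: block_mag_ge0.
pose E := 4 * D / (1 - 2 * vkappa).
have E0 : 0 <= E by rewrite divr_ge0 ?(ltW vk') ?mulr_ge0.
have k0 : 0 <= kappa by exact: le_trans vkk.
have beta1 : 1 <= beta.
  rewrite /beta -addrA lerDl subr_ge0; apply: le_trans vkk _.
  by rewrite ler_pdivlMr ?ler_wpM2l // mulr_gt0.
have C0 : 0 <= E * beta by rewrite mulr_ge0 //; lra.
have z0 k : 0 <= block_mag z k by exact: block_mag_ge0.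
have l1E : \sum_k block_mag z k <= lambda / 2 * E.
  by rewrite -block_lp1E; apply: le_trans l1 _; rewrite /E; lra.
have [cardJ topJ] := selP z s_leK.
have topq : lp_norm q (fun k => if k \in sel s z then block_mag z k else 0) <=
    #|sel s z|%:R `^ rinv q * (E * beta).
  rewrite -block_lspE cardJ; apply: le_trans (Qq _) _.
  rewrite -/z -/a powRD ?(gt_eqF s0) ?implybT // powR_inv1 ?ler0n //.
  rewrite (_ : _ + _ = s%:R `^ rinv q * (a + kappa / s%:R * block_lp 1%E z)).
    rewrite ler_wpM2l ?powR_ge0 //.
    have -> : E * beta = (1 - vkappa) * E + kappa / s%:R * (lambda / 2 * E).
      by rewrite /beta; field; rewrite gt_eqF.
    rewrite lerD //; first by apply: le_trans aB _; rewrite /E; lra.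
    by rewrite block_lp1E ler_wpM2l // divr_ge0 // ltW.
  by ring.
(* The tail is allotted the weight lambda - s, which is at least lambda / 2. *)
have lq : lp_norm q (block_mag z) <= lambda `^ rinv q * (E * beta).
  have -> : lambda = #|sel s z|%:R + (lambda - #|sel s z|%:R) by lra.
  apply: lp_norm_of_retained => //; rewrite ?cardJ //; first lra.
  apply: le_trans l1E _; apply: ler_pM => //; [lra|lra|].
  by rewrite ler_peMr.
rewrite (_ : _ * D = lambda `^ rinv p * (E * beta `^ pq_exponent p q)); last first.
  by rewrite /E; ring.
apply: lp_norm_interpolation lq => //; first lra.
apply: le_trans l1E _; rewrite ler_wpM2r //; lra.
Qed.
End PenalizedRecovery.

Theorem theorem3p3 (R : realType) (m n K M : nat)
  (A : 'M[R]_(m, n))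
  (U : set 'cV[R]_m) (U_compact : compact U)
  (U_convex : convex_set (U : set (convex_lmodType 'cV[R]_m)))
  (U_sym : forall u, U u -> U (- u))
  (S : rep_struct R n K)
  (sel : nat -> rs_vec R S -> {set 'I_K}) (selP : block_selection sel)
  (s : nat) (s_gt0 : (0 < s)%N) (s_leK : (s <= K)%N)
  (q : \bar R) (q_ge1 : (1 <= q)%E)
  (H : 'M[R]_(m, M)) (nu : 'cV[R]_M -> R) (nuP : is_norm nu)
  (kappa vkappa : R) (kappa_ge0 : 0 <= kappa) (vkappa_ge0 : 0 <= vkappa)
  (Qq : condQ sel A H nu s q kappa)
  (Q1 : condQ sel A H nu s 1%E vkappa)
  (vkappa_lt : vkappa < 1 / 2) (vkappa_le : vkappa <= kappa)
  (lambda : R) (lambda_gt0 : 0 < lambda) :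
  ((2 * s%:R <= lambda ->
    forall (x : 'cV[R]_n) (y : 'cV[R]_m) (p : \bar R) (xpen : 'cV[R]_n),
      (1 <= p)%E -> (p <= q)%E -> pen_argmin S A H nu lambda y xpen ->
      block_lp p (rs_mat S *m (xpen - x)) <=
        4 * lambda `^ rinv p / (1 - 2 * vkappa)
        * (1 + kappa * lambda / (2 * s%:R) - vkappa) `^ pq_exponent p q
        * (nu (H^T *m (A *m x - y))
           + (2 * s%:R)^-1
             * block_lp 1%E (rs_mat S *m x - block_trunc sel s (rs_mat S *m x))))
   /\
   (lambda = 2 * s%:R ->
    forall (x : 'cV[R]_n) (y : 'cV[R]_m) (p : \bar R) (xpen : 'cV[R]_n),
      (1 <= p)%E -> (p <= q)%E -> pen_argmin S A H nu lambda y xpen ->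
      block_lp p (rs_mat S *m (xpen - x)) <=
        4 * (2 * s%:R) `^ rinv p / (1 - 2 * vkappa)
        * (1 + kappa - vkappa) `^ pq_exponent p q
        * (nu (H^T *m (A *m x - y))
           + (2 * s%:R)^-1
             * block_lp 1%E (rs_mat S *m x - block_trunc sel s (rs_mat S *m x)))))
  /\
  (forall (rho : R), 0 <= rho ->
   forall (x : 'cV[R]_n) (u xi : 'cV[R]_m) (p : \bar R) (xpen : 'cV[R]_n),
     U u -> noise_set U H nu rho xi -> (1 <= p)%E -> (p <= q)%E ->
     pen_argmin S A H nu lambda (A *m x + u + xi) xpen ->
     (2 * s%:R <= lambda ->
      block_lp p (rs_mat S *m (xpen - x)) <=
        4 * lambda `^ rinv p / (1 - 2 * vkappa)
        * (1 + kappa * lambda / (2 * s%:R) - vkappa) `^ pq_exponent p q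
        * (rho
           + (2 * s%:R)^-1
             * block_lp 1%E (rs_mat S *m x - block_trunc sel s (rs_mat S *m x))))
     /\
     (lambda = 2 * s%:R ->
      block_lp p (rs_mat S *m (xpen - x)) <=
        4 * (2 * s%:R) `^ rinv p / (1 - 2 * vkappa)
        * (1 + kappa - vkappa) `^ pq_exponent p q
        * (rho
           + (2 * s%:R)^-1
             * block_lp 1%E (rs_mat S *m x - block_trunc sel s (rs_mat S *m x))))).
Proof.
have bound x y p xpen : 2 * s%:R <= lambda -> (1 <= p)%E -> (p <= q)%E ->
    pen_argmin S A H nu lambda y xpen -> _ :=
  fun l2s p1 pq pen => penalized_recovery_bound selP s_gt0 s_leK nuP x
    p1 pq vkappa_ge0 vkappa_lt vkappa_le Qq Q1 l2s pen.
have lambda2s : lambda = 2 * s%:R -> kappa * lambda / (2 * s%:R) = kappa.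
  by move=> <-; rewrite mulfK // gt_eqF.
have vk' : 0 < 1 - 2 * vkappa by lra.
split.
  split=> [l2s x y p xpen p1 pq pen|l2s x y p xpen p1 pq pen]; first exact: bound.
  have := bound x y p xpen _ p1 pq pen.
  by rewrite lambda2s // l2s lexx; exact.
move=> rho rho0 x u xi p xpen Uu noise p1 pq pen.
have noise_le : nu (H^T *m (A *m x - (A *m x + u + xi))) <= rho.
  rewrite -addrA opprD addNKr mulmxN is_normN //; exact: noise.
have general : 2 * s%:R <= lambda ->
    block_lp p (rs_mat S *m (xpen - x)) <=
      4 * lambda `^ rinv p / (1 - 2 * vkappa)
      * (1 + kappa * lambda / (2 * s%:R) - vkappa) `^ pq_exponent p q
      * (rho + (2 * s%:R)^-1
         * block_lp 1%E (rs_mat S *m x - block_trunc sel s (rs_mat S *m x))).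
  move=> l2s; apply: le_trans (bound _ _ _ _ l2s p1 pq pen) _.
  by rewrite ler_wpM2l ?lerD2r // mulr_ge0 ?powR_ge0 // divr_ge0 ?(ltW vk')
    ?mulr_ge0 ?powR_ge0.
split=> // l2s.
by move: general; rewrite lambda2s // l2s lexx; exact.
Qed.
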